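(* Let $L\ge1$ and fix integers $0=k_0<k_1<k_2<\dots<k_L$. For every $\gamma\in(0,1]$ and every $K>1$ there exist $\delta>0$, $\epsilon>0$ and $C\ge 1$, depending only on $\gamma$, $K$ and $k_1,\dots,k_L$, such that the following holds. Let $\Psi(t)=x+y_1t^{k_1}+\dots+y_Lt^{k_L}$ be a real polynomial with $x,y_L\ne0$ and $\max_{1\le j\le L}|y_j|=1$, and suppose there is $m\in\{1,\dots,L\}$ such that $|y_m|^{1/k_m}\ge\gamma$ and $|y_n|^{1/k_n}\le\delta$ for all $n$ with $m<n\le L$. Then there are integers $s(1),s(2)\ge0$ with $s=s(1)+s(2)$, $1\le s\le L$, and a partition of the multiset of complex roots of $\Psi$ into non-empty tiers $\mathcal{T}_1,\dots,\mathcal{T}_s$ such that: (i) for any choice of $w_i\in\mathcal{T}_i$, $|w_i|\ge K|w_{i+1}|$ for $1\le i<s$; (ii) $|w|\ge C^{-1}$ for every $w\in\mathcal{T}_r$ with $1\le r\le s(1)$ (large tiers), and $|w|\le C$ for every $w\in\mathcal{T}_r$ with $s(1)<r\le s(1)+s(2)$ (small tiers); (iii) for every $w\in\mathcal{T}_r$ with $1\le r\le s(1)$, the ball $B(w,\epsilon|w|)$ contains at most $L-m+1$ roots of $\Psi$; (iv) if $s(2)\ge1$, then for every $w\in\mathcal{T}_r$ with $s(1)<r\le s(1)+s(2)$ the ball $B(w,\epsilon|w|)$ contains at most $m$ roots of $\Psi$, and for every $w\in\mathcal{T}_r$ with $1\le r\le s(1)$ the ball $B(w,\epsilon|w|)$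 contains at most $L-m$ roots of $\Psi$.
   Context: Roots are complex and counted with multiplicity (sets of roots are multisets). $B(w,R)$ is the open ball in $\mathbb{C}$ of centre $w$ and radius $R$. *)

(* Defs.v *)
From HB Require Import structures.
From mathcomp Require Import all_boot all_order all_algebra.
From mathcomp Require Import complex reals exp.

Set Implicit Arguments.
Unset Strict Implicit.
Unset Printing Implicit Defensive.

Import Order.TTheory GRing.Theory Num.Theory.

Local Open Scope ring_scope.
Local Open Scope complex_scope.

(* The exponents and coefficients are indexed by 0, ..., L; y ord0 is unused. *)
Definition sparse_poly (R : realType) (L : nat) (k : 'I_L.+1 -> nat) (x : R)
    (y : 'I_L.+1 -> R) : {poly R} :=
  x%:P + \sum_(j < L.+1 | (0 < j)%N) y j *: 'X^(k j).

(* Multisets are represented by sequences up to perm_eq. *)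
Definition complex_roots (R : realType) (p : {poly R}) : seq R[i] :=
  sval (closed_field_poly_normal (map_poly (real_complex R) p)).

Lemma complex_rootsE (R : realType) (p : {poly R}) :
  map_poly (real_complex R) p =
  (lead_coef p)%:C *: \prod_(z <- complex_roots p) ('X - z%:P).
Proof.
rewrite /complex_roots; case: closed_field_poly_normal => /= r {1}->.
by rewrite lead_coef_map.
Qed.

Lemma count_complex_roots (R : realType) (p : {poly R}) (w : R[i]) :
  p != 0 ->
  count_mem w (complex_roots p) = mup w (map_poly (real_complex R) p).
Proof.
move=> p0; rewrite complex_rootsE -mul_polyC mupMr ?mu_prod_XsubC//.
by rewrite rootC fmorph_eq0 lead_coef_eq0.
Qed.

(* Normc.normc is the R-valued modulus: `|z| = (Normc.normc z)%:C. *)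
Definition cball (R : realType) (w : R[i]) (r : R) : pred R[i] :=
  fun z => Normc.normc (z - w) < r.

Definition num_roots_in (R : realType) (p : {poly R}) (B : pred R[i]) : nat :=
  count B (complex_roots p).

(* T r is meaningful for 1 <= r <= s only. *)
Definition tier_partition (R : realType) (s : nat) (T : nat -> seq R[i])
    (rts : seq R[i]) : Prop :=
  perm_eq (flatten [seq T r | r <- iota 1 s]) rts /\
  (forall r : nat, (1 <= r <= s)%N -> T r != [::]).

(* Main.v *)
Require Import Defs.
From HB Require Import structures.
From mathcomp Require Import all_boot all_order all_algebra.
From mathcomp Require Import complex reals exp.
From mathcomp Require Import ring lra zify.

(* Tiers. If the roots, sorted by decreasing modulus, split as [l ++ t] with a
   large enough multiplicative gap between [l] and [t], then the coefficient of
   [Psi] of index [size t] does not vanish, hence is one of the [k j]. Counting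
   the extreme indices [0] and [k L] as well, there are at most [L - 1] such
   gaps, and cutting at all of them gives the tiers.

   Local root counts. Rescaled at a root [w], [Psi] is the sum of the
   [b j * w ^ k j * t ^ k j], near [t = 1]. If the terms [j] outside a set [I]
   are negligible, some Taylor coefficient at [t = 1] of order less than [#|I|]
   is large, because a suitable composite of [#|I| - 1] operators
   [t d/dt - k i] isolates the largest term. So fewer than [#|I|] roots lie in
   a small ball about [t = 1].

   Choice of [I]. If [|x|] exceeds a threshold, all roots are large and
   [I = {0} U [m, L]]. Otherwise the term [m] dominates all the others in an
   annulus [A1 <= |w| <= A2], which therefore contains no root and separates
   the large roots, [I = [m, L]], from the small ones, [I = [0, m]]. *)

Set Implicit Arguments.
Unset Strict Implicit.
Unset Printing Implicit Defensive.

Import Order.TTheory GRing.Theory Num.Theory.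

Local Open Scope ring_scope.
Local Open Scope complex_scope.

Local Notation normc := Normc.normc.

(** * The modulus of complex numbers *)

Lemma normcD (R : rcfType) (x y : R[i]) : normc (x + y) <= normc x + normc y.
Proof. exact: (le_normcD x y). Qed.

Lemma normc_opp (R : rcfType) (x : R[i]) : normc (- x) = normc x.
Proof. exact: (normcN x). Qed.

Lemma normcB (R : rcfType) (x y : R[i]) : normc (x - y) <= normc x + normc y.
Proof. by rewrite -(normc_opp y) normcD. Qed.

Lemma normcB_ge (R : rcfType) (x y : R[i]) : normc x - normc y <= normc (x + y).
Proof. by rewrite lerBlDr -{1}[x](addrK y); exact: normcB. Qed.

Lemma normc_ge0 (R : rcfType) (x : R[i]) : 0 <= normc x.
Proof. by case: x => a b; exact: sqrtr_ge0. Qed.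

Lemma normc_eq0 (R : rcfType) (x : R[i]) : (normc x == 0) = (x == 0).
Proof.
apply/eqP/eqP => [|->]; first exact: Normc.eq0_normc.
exact: Normc.normc0.
Qed.

Lemma normc_gt0 (R : rcfType) (x : R[i]) : (0 < normc x) = (x != 0).
Proof. by rewrite lt_neqAle normc_ge0 andbT eq_sym normc_eq0. Qed.

Lemma normcX (R : rcfType) (x : R[i]) n : normc (x ^+ n) = normc x ^+ n.
Proof.
elim: n => [|n IH]; first exact: Normc.normc1.
by rewrite !exprS Normc.normcM IH.
Qed.

Lemma normc_real (R : rcfType) (a : R) : normc a%:C = `|a|.
Proof. by rewrite /normc /= expr0n /= addr0 sqrtr_sqr. Qed.

Lemma normc_nat (R : rcfType) (n : nat) : normc (n%:R : R[i]) = n%:R.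
Proof. by rewrite -(rmorph_nat (real_complex R)) normc_real normr_nat. Qed.

Lemma normc_sum (R : rcfType) (I : Type) (r : seq I) (P : pred I)
    (F : I -> R[i]) :
  normc (\sum_(i <- r | P i) F i) <= \sum_(i <- r | P i) normc (F i).
Proof.
apply: (big_ind2 (fun x y => normc x <= y)) => //.
- by rewrite Normc.normc0.
- move=> x1 x2 y1 y2 h1 h2; apply: (le_trans (normcD _ _)); exact: lerD.
Qed.

Lemma normc_sum_le (R : rcfType) (I : finType) (P : pred I) (F : I -> R[i])
    (c : R) :
  0 <= c -> (forall i, P i -> normc (F i) <= c) ->
  normc (\sum_(i | P i) F i) <= #|I|%:R * c.
Proof.
move=> c0 h; apply: le_trans (normc_sum _ _ _) _.
apply: le_trans (ler_sum _ h) _.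
by rewrite sumr_const -[c *+ _]mulr_natl ler_wpM2r// ler_nat max_card.
Qed.

Lemma normc_prod (R : rcfType) (I : Type) (r : seq I) (P : pred I)
    (F : I -> R[i]) :
  normc (\prod_(i <- r | P i) F i) = \prod_(i <- r | P i) normc (F i).
Proof.
apply: (big_morph (fun z : R[i] => normc z)) => [x y|].
  exact: Normc.normcM.
exact: Normc.normc1.
Qed.

(** * Roots near a point of low order *)

Lemma coefXsubCM (R : rcfType) (a : R[i]) (q : {poly R[i]}) i :
  (('X - a%:P) * q)`_i = (if i is j.+1 then q`_j else 0) - a * q`_i.
Proof. by rewrite mulrBl coefB coefXM mul_polyC coefZ; case: i. Qed.

(** Comparing coefficients in [p = ('X - a) * q] gives [q_i = p_(i+1) + a q_(i+1)]. Descending from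
    the top degree, each step costs at most one more [M], since [a] has modulus at most 1. *)
Lemma normc_coef_divXsubC (R : rcfType) (a : R[i]) (q : {poly R[i]}) (M : R) d :
  (size q <= d)%N -> normc a <= 1 -> 0 <= M ->
  (forall i, normc (('X - a%:P) * q)`_i <= M) ->
  forall i, normc q`_i <= d%:R * M.
Proof.
move=> sq a1 M0 hM.
have key : forall j i, (d <= i + j)%N -> normc q`_i <= j%:R * M.
  elim=> [|j IH] i; first by rewrite addn0 mul0r => di;
    rewrite nth_default ?Normc.normc0// (leq_trans sq).
  rewrite addnS -addSn => /IH hi.
  have -> : q`_i = (('X - a%:P) * q)`_i.+1 + a * q`_i.+1.
    by rewrite coefXsubCM subrK.
  apply: le_trans (normcD _ _) _.
  rewrite -[j.+1%:R]natr1 [(_ + 1) * M]mulrDl mul1r addrC lerD// Normc.normcM.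
  by apply: le_trans hi; rewrite ler_piMl ?normc_ge0.
by move=> i; apply: key; rewrite leq_addl.
Qed.

(* Dividing by a linear factor [X - a] with [a] small moves the large
   low-order coefficient down by one place. *)
Lemma count_small_roots (R : rcfType) (d N : nat) (M : R) : 0 < M ->
  exists2 eps : R, 0 < eps & forall n : nat, (n <= N)%N ->
    forall (c : R[i]) (rs : seq R[i]) (kappa : R),
    (size rs <= d)%N -> 0 < kappa ->
    let p := c *: \prod_(z <- rs) ('X - z%:P) in
    (forall i, normc p`_i <= M * kappa) ->
    (exists2 i, (i < n)%N & kappa <= normc p`_i) ->
    (count (fun z => normc z < eps)%R rs < n)%N.
Proof.
elim: N M => [|N IH] M M0.
  by exists 1 => // n; rewrite leqn0 => /eqP-> c rs kappa _ _ p _ [].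
have d0 : (0 : R) <= d%:R by [].
(* The quotient has coefficients at most [d * M * kappa] and its large one is only known to reach
   [kappa / 2], so the ratio passed to the induction is [2 * d.+1 * M]. *)
have M'0 : 0 < 2 * d.+1%:R * M by rewrite !mulr_gt0// ltr0Sn.
have [e e0 he] := IH _ M'0.
(* The three bounds serve the induction on the quotient, the division estimate ([normc a <= 1]), and
   [normc (a * q_i) <= kappa / 2]. *)
pose e' := Num.min e (Num.min 1 (2 * d.+1%:R * M)^-1).
exists e'; first by rewrite !lt_min e0 invr_gt0 M'0 ltr01.
case=> [|n] nN c rs kappa srs k0 p hM [] // i0 i0n hi0.
have [|nhas] := boolP (has (fun z : R[i] => normc z < e') rs); last first.
  by rewrite ltnS; move: nhas; rewrite has_count -leqNgt leqn0 => /eqP->.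
case/hasP => a ars ae'.
have prs : perm_eq rs (a :: rem a rs) by rewrite perm_to_rem.
have ae : normc a < 1 /\ normc a * (2 * d.+1%:R * M) < 1.
  move: ae'; rewrite !lt_min => /and3P[_ -> h]; split=> //.
  by rewrite -ltr_pdivlMr// div1r.
rewrite (permP prs) /= ae' add1n ltnS.
pose q := c *: \prod_(z <- rem a rs) ('X - z%:P).
have pq : p = ('X - a%:P) * q.
  by rewrite /p (perm_big _ prs) /= big_cons /q scalerAr.
have srem : (size (rem a rs) < size rs)%N.
  by rewrite size_rem// prednK //; case: (rs) ars.
have sq : (size q <= d)%N.
  rewrite (leq_trans (size_scale_leq _ _))// size_prod_XsubC.
  exact: leq_trans srem srs.
have Mk0 : 0 <= M * kappa by rewrite mulr_ge0 ?ltW.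
have hq : forall i, normc q`_i <= d%:R * (M * kappa).
  apply: (normc_coef_divXsubC sq (ltW ae.1) Mk0) => i.
  by rewrite -pq.
have aq i : normc (a * q`_i) <= kappa / 2.
  rewrite Normc.normcM.
  apply: (@le_trans _ _ (normc a * (d.+1%:R * (M * kappa)))).
    rewrite ler_wpM2l ?normc_ge0//; apply: le_trans (hq i) _.
    by rewrite ler_wpM2r// ler_nat.
  have := ae.2; set t := normc a; set D := d.+1%:R => h.
  have : t * (2 * D * M) * kappa <= 1 * kappa by rewrite ler_pM2r// ltW.
  lra.
move: hi0; rewrite pq coefXsubCM.
(* Index 0 is impossible: that coefficient is [- a * q_0], of modulus at most [kappa / 2]. Otherwise
   [q_(i0)] keeps at least half of [kappa], one index lower. *)
case: i0 i0n => [_|i0 i0n].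
  rewrite sub0r normc_opp => h; have := aq 0%N; lra.
move=> h.
have hk : kappa / 2 <= normc q`_i0.
  have := le_trans h (normcB _ _); have := aq i0.+1; lra.
apply: leq_ltn_trans (he n nN c (rem a rs) (kappa / 2) _ _ _ _).
- apply: sub_count => z /=; rewrite /e' lt_min => /andP[] //.
- exact: leq_trans (ltnW srem) srs.
- by rewrite divr_gt0.
- move=> i; apply: le_trans (hq i) _.
  have : d%:R * (M * kappa) <= d.+1%:R * (M * kappa).
    by rewrite ler_wpM2r// ler_nat.
  lra.
- by exists i0.
Qed.

(* The operator [t d/dt - e] in the variable [t = 1 + X]; it kills the
   monomial [t ^ e]. *)
Definition euler_op (R : rcfType) (p : {poly R[i]}) (e : nat) : {poly R[i]} :=
  ('X + 1) * p^`() - e%:R *: p.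

Definition euler_ops (R : rcfType) (s : seq nat) (p : {poly R[i]}) :=
  foldl (@euler_op R) p s.

(** Each power [t ^ n] of [t = 1 + X] is an eigenvector of [t d/dt] with eigenvalue [n], so the
    operators act diagonally on the sum. *)
Lemma euler_opsE (R : rcfType) (I : finType) (s : seq nat) (b : I -> R[i])
    (k : I -> nat) :
  euler_ops s (\sum_j b j *: ('X + 1) ^+ (k j)) =
  \sum_j (b j * \prod_(e <- s) ((k j)%:R - e%:R)) *: ('X + 1) ^+ (k j).
Proof.
elim: s b => [|e s IH] b.
  by apply: eq_bigr => j _; rewrite big_nil mulr1.
rewrite /euler_ops /= -/(euler_ops s _).
have -> : euler_op (\sum_j b j *: ('X + 1) ^+ k j) e =
    \sum_j (b j * ((k j)%:R - e%:R)) *: ('X + 1) ^+ k j.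
  rewrite /euler_op raddf_sum mulr_sumr scaler_sumr -sumrB.
  apply: eq_bigr => j _.
  rewrite /= derivZ deriv_exp derivD derivX derivC addr0 mul1r.
  rewrite -scalerAr mulrnAr mulrBr scalerBl; congr (_ - _); last first.
    by rewrite scalerA mulrC.
  case: (k j) => [|n]; first by rewrite !mulr0n scaler0 mulr0 scale0r.
  by rewrite -exprS -scaler_nat scalerA.
rewrite IH; apply: eq_bigr => j _.
by rewrite big_cons mulrA.
Qed.

(** One operator turns coefficient [i] into [i p_i + (i+1) p_(i+1) - e p_i]. Hence the constant term
    after [size s] operators sees only the orders up to [size s], and each operator costs one factor
    [2 N + 1 + D]. *)
Lemma normc_euler_ops_le (R : rcfType) (s : seq nat) (N D : nat) (rho : R)
    (p : {poly R[i]}) :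
  (size s <= N)%N -> {in s, forall e, (e <= D)%N} ->
  0 <= rho ->
  (forall i, (i <= size s)%N -> normc p`_i <= rho) ->
  normc (euler_ops s p)`_0 <= (2 * N + 1 + D)%:R ^+ N * rho.
Proof.
have B1 : 1 <= (2 * N + 1 + D)%:R :> R by rewrite ler1n; lia.
suff key : forall (rho : R) (p : {poly R[i]}), (size s <= N)%N -> {in s, forall e, (e <= D)%N} ->
  0 <= rho -> (forall i, (i <= size s)%N -> normc p`_i <= rho) ->
  normc (euler_ops s p)`_0 <= (2 * N + 1 + D)%:R ^+ size s * rho.
  move=> sN sD r0 hp; apply: le_trans (key _ _ sN sD r0 hp) _.
  by rewrite ler_wpM2r// ler_weXn2l.
elim: s => [|e s IH] {}rho {}p sN sD r0 hp.
  by rewrite expr0 mul1r hp.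
rewrite /= exprSr -mulrA; apply: IH.
- exact: ltnW.
- by move=> f fs; apply: sD; rewrite inE fs orbT.
- by rewrite mulr_ge0.
move=> i hi.
rewrite /euler_op coefB coefZ mulrDl coefD mul1r coefXM [p^`()`_i]coef_deriv.
have -> : (if i == 0%N then 0 else p^`()`_i.-1) = i%:R * p`_i.
  case: i {hi} => [|i]; first by rewrite mul0r.
  by rewrite /= coef_deriv mulr_natl.
rewrite -[_ *+ i.+1]mulr_natl.
have hi0 := hp i (leqW hi).
have hi1 := hp i.+1 hi.
have h1 : normc (i%:R * p`_i) <= N%:R * rho.
  rewrite Normc.normcM normc_nat ler_pM ?normc_ge0 ?ler_nat//.
  by rewrite /= in sN; lia.
have h2 : normc (i.+1%:R * p`_i.+1) <= (N + 1)%:R * rho.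
  rewrite Normc.normcM normc_nat ler_pM ?normc_ge0 ?ler_nat//.
  by rewrite /= in sN; lia.
have h3 : normc (e%:R * p`_i) <= D%:R * rho.
  rewrite Normc.normcM normc_nat ler_pM ?normc_ge0 ?ler_nat//.
  by apply: sD; rewrite inE eqxx.
apply: le_trans (normcB _ _) _.
have := normcD (i%:R * p`_i) (i.+1%:R * p`_i.+1).
have -> : (2 * N + 1 + D)%:R = 2 * N%:R + 1 + D%:R :> R.
  by rewrite natrD natrD natrM.
move: h1 h2 h3; rewrite (natrD _ N 1); lra.
Qed.

Lemma normc_coef_expX1 (R : rcfType) e i :
  normc ((('X + 1) ^+ e : {poly R[i]})`_i) <= 2 ^+ e.
Proof.
elim: e i => [|e IH] i.
  by rewrite expr0 coef1 normc_nat lern1 leq_b1.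
rewrite exprS mulrDl mul1r coefD coefXM exprS mulrDl mul1r.
apply: le_trans (normcD _ _) _; apply: lerD => //.
by case: eqP => // _; rewrite Normc.normc0 exprn_ge0.
Qed.

Lemma normc_prod_subn_le (R : rcfType) (D n : nat) (s : seq nat) :
  (n <= D)%N -> {in s, forall e, (e <= D)%N} ->
  normc (\prod_(e <- s) (n%:R - e%:R) : R[i]) <= D.+1%:R ^+ size s.
Proof.
move=> nD; rewrite normc_prod; elim: s => [|e s IH] sD.
  by rewrite big_nil expr0.
have eD : (e <= D)%N by apply: sD; rewrite inE eqxx.
rewrite big_cons /= exprS; apply: ler_pM; rewrite ?normc_ge0//.
- by apply: prodr_ge0 => ? _; exact: normc_ge0.
- have [h|/ltnW h] := leqP e n.
  + by rewrite -natrB// normc_nat ler_nat; lia.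
  + by rewrite -normc_opp opprB -natrB// normc_nat ler_nat; lia.
- by apply: IH => f fs; apply: sD; rewrite inE fs orbT.
Qed.

(* A polynomial in [t = 1 + X] whose [#|I|] main monomials dominate the others
   cannot vanish to order close to [#|I|] at [t = 1]: applying the operators
   [t d/dt - k i] for all main exponents but the largest term's isolates that
   term. *)
Lemma large_low_coef (R : rcfType) (L D : nat) (k : 'I_L.+1 -> nat)
    (kinj : injective k) (kD : forall j, (k j <= D)%N) (I : {set 'I_L.+1})
    (b : 'I_L.+1 -> R[i]) (j0 : 'I_L.+1) :
  j0 \in I ->
  (forall j, normc (b j) <= normc (b j0)) ->
  (forall j, j \notin I ->
     4 * L.+1%:R * D.+1%:R ^+ L * normc (b j) <= normc (b j0)) ->
  let kap := (4 * (2 * L + 1 + D)%:R ^+ L)^-1 * normc (b j0) in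
  b j0 != 0 ->
  exists2 i : nat, (i < #|I|)%N &
    kap <= normc (\sum_j b j *: ('X + 1) ^+ (k j) : {poly R[i]})`_i.
Proof.
move=> j0I hall hout kap bj0.
have nb0 : 0 < normc (b j0) by rewrite normc_gt0.
have B0 : 0 < (2 * L + 1 + D)%:R ^+ L :> R.
  by rewrite exprn_gt0// ltr0n; lia.
have kap0 : 0 < kap by rewrite mulr_gt0// invr_gt0 mulr_gt0.
set p := \sum_j _.
have [/existsP[i hi]|/existsPn hno] :=
  boolP [exists i : 'I_#|I|, kap <= normc p`_i].
  by exists i => //; exact: ltn_ord.
exfalso.
(* These [#|I| - 1] operators kill every main term except [j0], and read only coefficients of order
   less than [#|I|], all assumed smaller than [kap]. *)
pose s := [seq k i | i <- enum (I :\ j0)].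
have Icard : #|I| = (size s).+1.
  by rewrite size_map -cardE (cardsD1 j0) j0I.
have sL : (size s <= L)%N.
  by have := max_card (mem I); rewrite card_ord Icard.
have sD : {in s, forall e, (e <= D)%N} by move=> e /mapP[j _ ->].
have := normc_euler_ops_le sL sD (ltW kap0) (p := p).
have hp i : (i <= size s)%N -> normc p`_i <= kap.
  rewrite -ltnS -Icard => iI; have := hno (Ordinal iI).
  by rewrite -ltNge => /ltW.
move=> /(_ hp).
have -> : (2 * L + 1 + D)%:R ^+ L * kap = normc (b j0) / 4.
  by rewrite /kap; field; rewrite gt_eqF.
rewrite euler_opsE coef_sum.
have c0 e : (('X + 1) ^+ e : {poly R[i]})`_0 = 1.
  elim: e => [|e IH]; first by rewrite expr0 coef1.
  by rewrite exprS mulrDl mul1r coefD coefXM add0r.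
under eq_bigr do rewrite coefZ c0 mulr1.
rewrite (bigD1 j0)//=.
(* [u] is the surviving main term and [v] the contribution of all the others. The contradiction is
   that [u] has modulus at least [normc (b j0)], while both [v] and [u + v] have modulus at most a
   quarter of it. *)
set u := b j0 * _; set v := \sum_(_ | _) _.
(* The factors [k j0 - k j] are nonzero integers, hence of modulus at least 1. *)
have hu : normc (b j0) <= normc u.
  rewrite /u Normc.normcM ler_peMr ?normc_ge0// normc_prod.
  rewrite big_seq; apply: (big_ind (fun x => 1 <= x)) => //.
    by move=> x y x1 y1; rewrite -[1]mulr1 ler_pM.
  move=> e /mapP[j]; rewrite mem_enum !inE => /andP[jj0 _] ->.
  have : k j0 != k j by rewrite (inj_eq kinj) eq_sym.
  rewrite neq_ltn => /orP[] h.
  - rewrite -normc_opp opprB -natrB 1?ltnW// normc_nat ler1n subn_gt0 //.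
  - rewrite -natrB 1?ltnW// normc_nat ler1n subn_gt0 //.
have hv : normc v <= #|'I_L.+1|%:R * (normc (b j0) / (4 * L.+1%:R)).
  apply: normc_sum_le => [|j jj0].
    by rewrite divr_ge0 ?normc_ge0 ?mulr_ge0.
  have [jI|jI] := boolP (j \in I).
    have js : k j \in s by apply: map_f; rewrite mem_enum !inE jj0.
    rewrite (big_rem (k j))//= subrr mul0r mulr0 Normc.normc0.
    by rewrite divr_ge0 ?normc_ge0 ?mulr_ge0.
  rewrite ler_pdivlMr ?mulr_gt0// ?ltr0n// mulrC.
  apply: le_trans (hout j jI).
  rewrite Normc.normcM -!mulrA ler_wpM2l// ler_wpM2l// mulrC ler_wpM2r ?normc_ge0//.
  apply: (@le_trans _ _ (D.+1%:R ^+ size s)); last first.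
    by rewrite ler_weXn2l// ler1n.
  exact: normc_prod_subn_le.
have N0 : 0 < L.+1%:R :> R by [].
move: hv N0; rewrite card_ord; set N1 := L.+1%:R => hv N0; move: hv.
have -> : N1 * (normc (b j0) / (4 * N1)) = normc (b j0) / 4.
  by field; lra.
have := normcB_ge u v; lra.
Qed.

Lemma few_roots_near_1 (R : rcfType) (L D : nat) :
  exists eps eta : R, [/\ 0 < eps, 0 < eta, eta <= 1 &
    forall (k : 'I_L.+1 -> nat), injective k -> (forall j, (k j <= D)%N) ->
    forall (I : {set 'I_L.+1}) (b : 'I_L.+1 -> R[i]) (m : 'I_L.+1),
    m \in I -> b m != 0 ->
    (forall j, j \notin I -> normc (b j) <= eta * normc (b m)) ->
    forall (c : R[i]) (rs : seq R[i]), (size rs <= D)%N ->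
    \sum_j b j *: ('X + 1) ^+ (k j) = c *: \prod_(z <- rs) ('X - z%:P) ->
    (count (fun z => normc z < eps)%R rs < #|I|)%N].
Proof.
pose B : R := 4 * (2 * L + 1 + D)%:R ^+ L.
have B0 : 0 < B by rewrite mulr_gt0// exprn_gt0// ltr0n; lia.
(* [M] is the ratio of the upper bound [L.+1 * 2 ^+ D * normc (b j0)] for all coefficients to the
   lower bound [B^-1 * normc (b j0)] for one of low order. *)
pose M : R := L.+1%:R * 2 ^+ D * B.
have M0 : 0 < M by apply: mulr_gt0 => //; rewrite mulr_gt0 ?exprn_gt0.
have [eps e0 heps] := count_small_roots D L.+1 M0.
pose E : R := 4 * L.+1%:R * D.+1%:R ^+ L.
have E1 : 1 <= E.
  rewrite /E -!natrX -!natrM ler1n.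
  by rewrite !muln_gt0 expn_gt0.
have E0 : 0 < E by exact: lt_le_trans E1.
exists eps, E^-1; split=> //; first by rewrite invr_gt0.
  by rewrite invf_le1.
move=> k kinj kD I b m mI bm hout c rs srs hp.
(* The largest term within [I] is the largest of all, because [eta <= 1]. *)
case: (@Order.TotalTheory.arg_maxP _ _ _ m (mem I) (fun j => normc (b j)) mI) => j0 j0I hj0.
have bmj0 : normc (b m) <= normc (b j0) by exact: hj0.
have bj00 : 0 < normc (b j0) by rewrite (lt_le_trans _ bmj0)// normc_gt0.
have hall j : normc (b j) <= normc (b j0).
  have [jI|jI] := boolP (j \in I); first exact: hj0.
  apply: le_trans (hout j jI) (le_trans _ bmj0).
  by rewrite ler_piMl ?normc_ge0// invf_le1.
have houtj j : j \notin I -> E * normc (b j) <= normc (b j0).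
  move=> jI; rewrite mulrC -ler_pdivlMr//; apply: le_trans (hout j jI) _.
  by rewrite mulrC ler_pM2r// invr_gt0.
have bj0n : b j0 != 0 by rewrite -normc_gt0.
have [i iI hi] := large_low_coef kinj kD j0I hall houtj bj0n.
have IL : (#|I| <= L.+1)%N by have := max_card (mem I); rewrite card_ord.
apply: (heps _ IL c rs (B^-1 * normc (b j0)) srs).
- by rewrite mulr_gt0// invr_gt0.
- move=> i'; rewrite -hp.
  have -> : M * (B^-1 * normc (b j0)) = #|'I_L.+1|%:R * (normc (b j0) * 2 ^+ D).
    by rewrite card_ord /M; field; rewrite gt_eqF.
  rewrite coef_sum; apply: normc_sum_le => [|j _].
    by rewrite mulr_ge0 ?normc_ge0 ?exprn_ge0.
  rewrite coefZ Normc.normcM ler_pM ?normc_ge0//.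
  apply: le_trans (normc_coef_expX1 _ _ _) _.
  by rewrite ler_weXn2l// ler1n.
- by exists i => //; rewrite -hp.
Qed.

(** * Gaps and tiers *)

(** Up to sign, the coefficient is a sum of at most [2 ^+ size l] products, each omitting [a] roots
    of modulus at least [mu]. *)
Lemma normc_coef_large_roots (R : rcfType) (mu : R) (l : seq R[i]) a :
  0 <= mu -> {in l, forall z, mu <= normc z} ->
  mu ^+ a * normc (\prod_(z <- l) ('X - z%:P))`_a
    <= 2 ^+ size l * \prod_(z <- l) normc z.
Proof.
move=> mu0; elim: l a => [|z l IH] a hl.
  rewrite !big_nil expr0 coef1 mulr1.
  by case: a => [|a]; rewrite ?expr0 normc_nat ?mulr1 ?mulr0.
have hz : mu <= normc z by apply: hl; rewrite inE eqxx.
have {}IH a' := IH a' (fun f fl => hl f (mem_behead (s := z :: _) fl)).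
rewrite !big_cons coefXsubCM /=.
set P := \prod_(j <- l) normc j in IH *; set A := \prod_(j <- l) _ in IH *.
have P0 : 0 <= P by apply: prodr_ge0 => ? _; exact: normc_ge0.
have h0 : mu ^+ a * normc (z * A`_a) <= 2 ^+ size l * (normc z * P).
  by rewrite Normc.normcM mulrCA [leRHS]mulrCA ler_wpM2l ?normc_ge0.
have h1 : mu ^+ a * normc (if a is j.+1 then A`_j else 0)
    <= 2 ^+ size l * (normc z * P).
  case: a {h0} => [|a].
    rewrite Normc.normc0 mulr0 mulr_ge0 ?exprn_ge0// mulr_ge0 ?normc_ge0//.
  rewrite exprS -mulrA [leRHS]mulrCA; apply: ler_pM => //.
  by rewrite mulr_ge0 ?exprn_ge0 ?normc_ge0.
rewrite exprS.
have : mu ^+ a * normc ((if a is j.+1 then A`_j else 0) - z * A`_a) <=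
  mu ^+ a * (normc (if a is j.+1 then A`_j else 0) + normc (z * A`_a)).
  by rewrite ler_wpM2l ?exprn_ge0 ?normcB.
lra.
Qed.

(** Here the coefficient is a sum of at most [2 ^+ size t] products of [size t - i] roots, each of
    modulus at most [rho]. *)
Lemma normc_coef_small_roots (R : rcfType) (rho : R) (t : seq R[i]) i :
  0 <= rho -> {in t, forall z, normc z <= rho} ->
  rho ^+ i * normc (\prod_(z <- t) ('X - z%:P))`_i
    <= 2 ^+ size t * rho ^+ size t.
Proof.
move=> rho0; elim: t i => [|z t IH] i ht.
  rewrite !big_nil !expr0 coef1 mulr1.
  by case: i => [|i]; rewrite ?expr0 normc_nat ?mulr1 ?mulr0.
have hz : normc z <= rho by apply: ht; rewrite inE eqxx.
have {}IH i' := IH i' (fun f fl => ht f (mem_behead (s := z :: _) fl)).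
rewrite !big_cons coefXsubCM /= !exprS.
set A := \prod_(j <- t) _ in IH *.
have h0 : rho ^+ i * normc (z * A`_i) <= rho * (2 ^+ size t * rho ^+ size t).
  rewrite Normc.normcM mulrCA; apply: ler_pM; rewrite ?normc_ge0//.
  by rewrite mulr_ge0 ?exprn_ge0 ?normc_ge0.
have h1 : rho ^+ i * normc (if i is j.+1 then A`_j else 0)
    <= rho * (2 ^+ size t * rho ^+ size t).
  case: i {h0} => [|i].
    by rewrite Normc.normc0 mulr0 !mulr_ge0 ?exprn_ge0.
  by rewrite exprS -mulrA ler_wpM2l.
have : rho ^+ i * normc ((if i is j.+1 then A`_j else 0) - z * A`_i) <=
  rho ^+ i * (normc (if i is j.+1 then A`_j else 0) + normc (z * A`_i)).
  by rewrite ler_wpM2l ?exprn_ge0 ?normcB.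
lra.
Qed.

(* If the roots in [l] are much larger than those in [t], the coefficient of
   index [size t] is governed by the product of the roots in [l]. *)
Lemma coef_at_gap_neq0 (R : rcfType) (D : nat) (K mu : R) (l t : seq R[i]) :
  (size l + size t <= D)%N -> D%:R * 2 ^+ D < K -> 1 <= K -> 0 < mu ->
  {in l, forall z, mu <= normc z} -> {in t, forall z, K * normc z <= mu} ->
  (\prod_(z <- l ++ t) ('X - z%:P))`_(size t) != 0.
Proof.
move=> sD KD K1 mu0 hl ht; rewrite big_cat /= coefM.
set A := \prod_(z <- l) _; set B := \prod_(z <- t) _.
have K0 : 0 < K by exact: lt_le_trans K1.
pose P := \prod_(z <- l) normc z.
have P0 : 0 < P.
  rewrite /P big_seq; apply: prodr_gt0 => z /hl; exact: lt_le_trans.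
have A0 : normc A`_0 = P.
  rewrite /A -horner_coef0 horner_prod normc_prod; apply: eq_bigr => z _.
  by rewrite !hornerE normc_opp.
have Bn : B`_(size t) = 1.
  have /monicP := monic_prod_XsubC t xpredT id.
  by rewrite /lead_coef size_prod_XsubC.
(* The first summand of the convolution is, up to sign, the product of the roots in [l]; [S]
   collects the rest. *)
rewrite big_ord_recl subn0 Bn mulr1 /=.
set S := \sum_(i < _) _.
suff hS : normc S < P.
  rewrite -normc_gt0; apply: lt_le_trans (normcB_ge _ _).
  by rewrite A0 subr_gt0.
(* With [rho = mu / K] in the small-root bound, the powers of [mu] cancel and each summand of [S]
   retains a factor [K ^- i.+1], at most [1 / K]. *)
have hSb : normc S <= (size t)%:R * (2 ^+ D * P / K).
  rewrite -[size t in leRHS]card_ord; apply: normc_sum_le => [|i _].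
    by rewrite !mulr_ge0 ?exprn_ge0 ?invr_ge0 ?ltW.
  rewrite Normc.normcM /= /bump add1n.
  have it : (i < size t)%N by [].
  have rho0 : 0 < mu / K by rewrite divr_gt0.
  have := normc_coef_large_roots i.+1 (ltW mu0) hl.
  have ht' : {in t, forall z, normc z <= mu / K}.
    by move=> z /ht h; rewrite ler_pdivlMr// mulrC.
  have := normc_coef_small_roots (size t - i.+1) (ltW rho0) ht'.
  rewrite -/A -/B -/P.
  set a := normc A`_i.+1; set b := normc _.
  have -> : (mu / K) ^+ size t = (mu / K) ^+ (size t - i.+1) * (mu / K) ^+ i.+1.
    by rewrite -exprD subnK.
  rewrite mulrCA ler_pM2l ?exprn_gt0// => hb ha.
  have m0 : 0 < mu ^+ i.+1 by rewrite exprn_gt0.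
  have -> : a * b = (mu ^+ i.+1 * a) * (b / mu ^+ i.+1).
    by field; rewrite gt_eqF.
  apply: (@le_trans _ _ ((2 ^+ size l * P) * (2 ^+ size t / K ^+ i.+1))).
    apply: ler_pM => //.
    - by rewrite mulr_ge0 ?normc_ge0 ?ltW.
    - by rewrite divr_ge0 ?normc_ge0 ?ltW.
    rewrite ler_pdivrMr//; apply: le_trans hb _.
    by rewrite expr_div_n mulrAC mulrA.
  have -> : 2 ^+ size l * P * (2 ^+ size t / K ^+ i.+1) =
     2 ^+ (size l + size t) * P / K ^+ i.+1 by rewrite exprD; ring.
  apply: ler_pM.
  - by rewrite mulr_ge0 ?exprn_ge0 ?ltW.
  - by rewrite invr_ge0 exprn_ge0 ?ltW.
  - by rewrite ler_wpM2r ?(ltW P0)// ler_weXn2l// ler1n.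
  - by rewrite lef_pV2 ?posrE ?exprn_gt0// exprS ler_peMr ?exprn_ege1 ?(ltW K0).
apply: le_lt_trans hSb _.
rewrite !mulrA ltr_pdivrMr// [P * K]mulrC ltr_pM2r//.
apply: le_lt_trans KD; rewrite ler_wpM2r ?exprn_ge0// ler_nat; lia.
Qed.

(** Meant for lists in decreasing modulus: a cut is made exactly where two neighbours differ by a
    factor [K], the head of the next tier being the right neighbour of [z]. *)
Fixpoint tiers (R : rcfType) (K : R) (s : seq R[i]) : seq (seq R[i]) :=
  if s is z :: s' then
    match tiers K s' with
    | t :: ts => if K * normc (head 0 t) <= normc z then [:: z] :: t :: ts
                 else (z :: t) :: ts
    | [::] => [:: [:: z]]
    end
  else [::].

Lemma flatten_tiers (R : rcfType) (K : R) (s : seq R[i]) :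
  flatten (tiers K s) = s.
Proof.
elim: s => [//|z s IH] /=; case: (tiers K s) IH => [|t ts] /= <- //.
by case: ifP.
Qed.

Lemma tiers_nonempty (R : rcfType) (K : R) (s : seq R[i]) :
  [::] \notin tiers K s.
Proof.
elim: s => [//|z s IH] /=; case: (tiers K s) IH => [|t ts] //=.
rewrite inE negb_or => /andP[h1 h2].
by case: ifP => _; rewrite !inE !negb_or ?h1 h2.
Qed.

Lemma tiers_eq_nil (R : rcfType) (K : R) (s : seq R[i]) :
  (tiers K s == [::]) = (s == [::]).
Proof. by case: s => //= z s; case: (tiers K s) => // t ts; case: ifP. Qed.

Lemma head_tiers (R : rcfType) (K : R) (z : R[i]) (s : seq R[i]) :
  head 0 (head [::] (tiers K (z :: s))) = z.
Proof. by rewrite /=; case: (tiers K s) => // t ts; case: ifP. Qed.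

(** The gap at the junction forces a cut there, so large and small roots can be tiered separately
    and still give the tiers of the whole list. *)
Lemma tiers_cat (R : rcfType) (K : R) (l t : seq R[i]) :
  0 <= K -> {in l & t, forall z z', K * normc z' <= normc z} ->
  tiers K (l ++ t) = tiers K l ++ tiers K t.
Proof.
move=> K0; elim: l => [//|z l IH] h.
rewrite /= IH; last by move=> x y xl yt; apply: h => //; rewrite inE xl orbT.
have [l0|ln0] := eqVneq l [::].
  rewrite l0 /=; case: t h {IH} => [//|z' t] h.
  case E : (tiers K (z' :: t)) => [|u us].
    by have := tiers_eq_nil K (z' :: t); rewrite E.
  have := head_tiers K z' t; rewrite E /= => ->.
  by rewrite h// inE eqxx.
case E : (tiers K l) => [|u us] /=; last by case: ifP.
by have := tiers_eq_nil K l; rewrite E (negbTE ln0).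
Qed.

Definition sorted_desc (R : rcfType) (s : seq R[i]) : bool :=
  sorted (fun z z' : R[i] => normc z' <= normc z) s.

Lemma normc_ge_trans (R : rcfType) :
  transitive (fun z z' : R[i] => normc z' <= normc z).
Proof. by move=> y x z h1 h2; exact: le_trans h2 h1. Qed.

Lemma tiers_sep (R : rcfType) (K : R) (s : seq R[i]) i :
  0 <= K -> sorted_desc s -> (i.+1 < size (tiers K s))%N ->
  {in nth [::] (tiers K s) i & nth [::] (tiers K s) i.+1,
    forall z z', K * normc z' <= normc z}.
Proof.
move=> K0; elim: s i => [//|z s IH] i /= hs.
have {}IH i := IH i (path_sorted hs).
have zmax : {in s, forall z', normc z' <= normc z}.
  by move=> z' z's; have /allP := order_path_min (@normc_ge_trans R) hs; apply.
have ne := tiers_nonempty K s; have fl := flatten_tiers K s.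
case E : (tiers K s) IH ne fl => [|t ts] IH ne fl //.
have hmax : {in t, forall z', normc z' <= normc (head 0 t)}.
  have : sorted (fun z z' : R[i] => normc z' <= normc z) (t ++ flatten ts).
    by rewrite -[t ++ _]/(flatten (t :: ts)) fl; exact: path_sorted hs.
  case: t {E IH ne fl} => // u t /= hu v; rewrite inE => /predU1P[->//|vt].
  have /allP := order_path_min (@normc_ge_trans R) hu; apply.
  by rewrite mem_cat vt.
case: ifP => hz.
  case: i => [|i] hi; last exact: IH.
  move=> x y /=; rewrite inE => /eqP-> yt.
  by apply: le_trans hz; rewrite ler_wpM2l// hmax.
(* Here [z] joins the tier [t]. It inherits the separation from the next tier because it dominates
   [head 0 t]. *)
case: i => [|i] hi; last by exact: (IH i.+1).
move=> x y /=; rewrite inE => /predU1P[->|xt] yu; last exact: (IH 0%N).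
have t0 : head 0 t \in t.
  by move: ne; case: (t) => [|u v] _ //=; rewrite inE eqxx.
apply: le_trans (zmax (head 0 t) _).
  exact: (IH 0%N).
by rewrite -fl /= mem_cat t0.
Qed.

Definition gap (R : rcfType) (K : R) (s : seq R[i]) (i : nat) : bool :=
  K * normc s`_i <= normc s`_i.-1.

Lemma size_tiers (R : rcfType) (K : R) (z : R[i]) (s : seq R[i]) :
  size (tiers K (z :: s)) = (count (gap K (z :: s)) (iota 1 (size s))).+1.
Proof.
elim: s z => [//|z' s IH] z.
move: (IH z') (head_tiers K z' s).
rewrite [tiers K (z :: _)]/= -/(tiers K (z' :: s)).
case E : (tiers K (z' :: s)) => [//|t ts] /= hsz ht.
rewrite -[2%N]/(1 + 1)%N iotaDl count_map.
rewrite (@eq_in_count _ _ (gap K (z' :: s))); last first.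
  by move=> i; rewrite mem_iota => /andP[i1 _] /=; rewrite /gap /=; case: i i1.
rewrite ht [gap K (z :: _) 1]/gap /=.
by case: ifP => /= _; lia.
Qed.

(** Each gap yields a nonzero coefficient strictly between the constant and the leading one. So the
    number of gaps plus two is at most [size e], while the number of tiers is the number of gaps
    plus one. *)
Lemma size_tiers_le (R : rcfType) (D : nat) (K : R) (s : seq R[i])
    (c : R[i]) (e : seq nat) :
  (size s <= D)%N -> D%:R * 2 ^+ D < K -> 1 <= K ->
  sorted_desc s -> 0 \notin s ->
  (forall i, (c *: \prod_(z <- s) ('X - z%:P))`_i != 0 -> i \in e) ->
  c != 0 ->
  s != [::] -> (size (tiers K s) < size e)%N.
Proof.
move=> sD KD K1 ss s0 he c0.
case: s sD ss s0 he => // z s sD ss s0 he _.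
pose Z := z :: s; rewrite -/Z in sD ss s0 he *.
rewrite size_tiers -/Z -size_filter.
set g := filter _ _.
(* The cut positions 0 and [size Z] account for the leading and the constant coefficient. *)
pose f := [seq (size Z - i)%N | i <- 0%N :: rcons g (size Z)].
have gP i : i \in g -> (0 < i < size Z)%N /\ gap K Z i.
  by rewrite mem_filter mem_iota add1n => /andP[-> ->].
suff : (size f <= size e)%N by rewrite size_map /= size_rcons.
apply: uniq_leq_size.
  rewrite map_inj_in_uniq.
    rewrite cons_uniq mem_rcons inE /= rcons_uniq filter_uniq ?iota_uniq// andbT.
    apply/andP; split; last by apply/negP => /gP[]; rewrite ltnn andbF.
    by apply/negP => /gP[].
  have hb i : i \in 0%N :: rcons g (size Z) -> (i <= size Z)%N.
    rewrite inE mem_rcons inE => /or3P[/eqP->|/eqP->|/gP[/andP[_ /ltnW]]] //.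
  by move=> i j /hb hi /hb hj; lia.
have mu_in i : (i < size Z)%N -> normc Z`_i > 0.
  move=> iZ; rewrite normc_gt0; apply: contraNneq s0 => <-; exact: mem_nth.
have key i (mu : R) : (i <= size Z)%N -> 0 < mu ->
    {in take i Z, forall z, mu <= normc z} ->
    {in drop i Z, forall z, K * normc z <= mu} -> (size Z - i)%N \in e.
  move=> iZ m0 h1 h2; apply: he; rewrite coefZ mulf_neq0//.
  rewrite -size_drop -[in X in \prod_(_ <- X) _](cat_take_drop i Z).
  apply: coef_at_gap_neq0 KD K1 m0 h1 h2.
  by rewrite -size_cat cat_take_drop.
have ord i j : (i <= j)%N -> (j < size Z)%N -> normc Z`_j <= normc Z`_i.
  move=> ij jZ.
  have rf : reflexive (fun z z' : R[i] => normc z' <= normc z).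
    by move=> x; exact: lexx.
  apply: (sorted_leq_nth (@normc_ge_trans R) rf 0 ss) => //.
  exact: leq_ltn_trans jZ.
move=> _ /mapP[i ii ->]; move: ii.
rewrite inE mem_rcons inE => /or3P[/eqP->|/eqP->|/gP[/andP[i0 iZ] gi]].
(* At the two extreme cuts one side is empty, so the threshold need only suit the other: [K] times
   the largest modulus, then the smallest modulus. *)
- have m0 : 0 < K * normc Z`_0.
    by rewrite mulr_gt0 ?mu_in// (lt_le_trans _ K1).
  apply: key m0 _ _; rewrite ?take0 ?drop0// => x xZ.
  rewrite ler_wpM2l ?(le_trans _ K1)//.
  by rewrite -(nth_index 0 xZ) ord// index_mem.
- apply: (key _ (normc Z`_(size s))) => //; first exact: mu_in.
    rewrite take_size => x xZ.
    by rewrite -(nth_index 0 xZ) ord// -ltnS -[(size s).+1]/(size Z) index_mem.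
  by rewrite drop_size.
- apply: (key _ (normc Z`_i.-1)); first exact: ltnW.
  + apply: mu_in; lia.
  + move=> x xZ; rewrite -(nth_index 0 xZ) nth_take; last first.
      by move: xZ; rewrite -index_mem size_take iZ.
    move: xZ; rewrite -index_mem size_take iZ => h; apply: ord.
    * by rewrite -ltnS prednK.
    * exact: leq_ltn_trans (leq_pred _) iZ.
  + move=> x xZ; rewrite -(nth_index 0 xZ) nth_drop.
    apply: le_trans gi; rewrite ler_wpM2l ?(le_trans _ K1)//.
    move: xZ; rewrite -index_mem size_drop => h; apply: ord.
    * exact: leq_addr.
    * by rewrite -ltn_subRL.
Qed.

(** Sorting the two kinds of roots separately ensures that no tier mixes them. The final equations
    record that [l] contains only large roots and [t] only the others. *)
Lemma tiers_exist (R : rcfType) (D : nat) (K : R) (rts : seq R[i])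
    (c : R[i]) (e : seq nat) (large : pred R[i]) :
  (size rts <= D)%N -> D%:R * 2 ^+ D < K -> 1 <= K -> 0 \notin rts ->
  (forall i, (c *: \prod_(z <- rts) ('X - z%:P))`_i != 0 -> i \in e) ->
  c != 0 -> rts != [::] ->
  {in rts &, forall z z', large z -> ~~ large z' -> K * normc z' <= normc z} ->
  exists (l t : seq R[i]),
    let ts := tiers K l ++ tiers K t in
    [/\ perm_eq (flatten ts) rts, [::] \notin ts, (0 < size ts < size e)%N,
        forall i, (i.+1 < size ts)%N ->
          {in nth [::] ts i & nth [::] ts i.+1,
            forall z z', K * normc z' <= normc z} &
        l = [seq z <- l | (z \in rts) && large z] /\
        t = [seq z <- t | (z \in rts) && ~~ large z]].
Proof.
move=> sD KD K1 rts0 he c0 rtsn hlarge.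
pose leT := fun z z' : R[i] => normc z' <= normc z.
have leTtot : total leT by move=> z z'; exact: le_total.
have leTtr : transitive leT by exact: normc_ge_trans.
pose l := sort leT [seq z <- rts | large z].
pose t := sort leT [seq z <- rts | ~~ large z].
have inl z : z \in l -> z \in rts /\ large z.
  by rewrite mem_sort mem_filter => /andP[].
have int z : z \in t -> z \in rts /\ ~~ large z.
  by rewrite mem_sort mem_filter => /andP[].
have K0 : 0 <= K by exact: le_trans K1.
have hlt : {in l & t, forall z z', K * normc z' <= normc z}.
  by move=> z z' /inl[zr zl] /int[zr' zl']; exact: hlarge.
exists l, t => ts.
have tsE : ts = tiers K (l ++ t) by rewrite tiers_cat.
have perm : perm_eq (l ++ t) rts.
  apply: (@perm_trans _ ([seq z <- rts | large z] ++ [seq z <- rts | ~~ large z])).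
    by apply: perm_cat; rewrite perm_sort.
  by rewrite perm_filterC.
have srt : sorted_desc (l ++ t).
  rewrite /sorted_desc sorted_pairwise// pairwise_cat.
  rewrite -!sorted_pairwise// !sort_sorted// !andbT.
  apply/allrelP => z z' zl zt; apply: le_trans (hlt _ _ zl zt).
  by rewrite ler_peMl ?normc_ge0.
have ltn : l ++ t != [::].
  by rewrite -size_eq0 (perm_size perm) size_eq0.
rewrite tsE; split.
- by rewrite flatten_tiers.
- exact: tiers_nonempty.
- rewrite lt0n size_eq0 tiers_eq_nil ltn /=.
  apply: (size_tiers_le (D := D) (c := c)) => //.
  + by rewrite (perm_size perm).
  + by rewrite (perm_mem perm).
  + by move=> i; rewrite (perm_big _ perm); exact: he.
- by move=> i hi; exact: tiers_sep.
- split; symmetry; apply/all_filterP/allP => z.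
  + by case/inl => -> ->.
  + by case/int => -> ->.
Qed.

Lemma tier_partition_nth (R : realType) (ts : seq (seq R[i])) (rts : seq R[i]) :
  perm_eq (flatten ts) rts -> [::] \notin ts ->
  tier_partition (size ts) (fun r => nth [::] ts r.-1) rts.
Proof.
move=> hp hn; split.
  rewrite -[1%N]addn0 iotaDl -map_comp.
  have -> : map ((fun r => nth [::] ts r.-1) \o addn 1) (iota 0 (size ts)) = ts.
    exact: mkseq_nth.
  exact: hp.
case=> [//|r] /andP[_ hr]; apply: contraNneq hn => <-; exact: mem_nth.
Qed.

(** * Sparse polynomials *)

(** The substitution of [w * (1 + X)] moves a root [z] to [z / w - 1], hence the ball
    [B(w, eps |w|)] to the ball of radius [eps] about 0. *)
Lemma recentre_sparse (R : rcfType) (I : finType) (k : I -> nat)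
    (b : I -> R[i]) (c w : R[i]) (rs : seq R[i]) :
  w != 0 -> \sum_j b j *: 'X^(k j) = c *: \prod_(z <- rs) ('X - z%:P) ->
  \sum_j (b j * w ^+ k j) *: ('X + 1) ^+ (k j) =
  (c * w ^+ size rs) *:
    \prod_(z <- [seq z / w - 1 | z <- rs]) ('X - z%:P).
Proof.
move=> w0 /(congr1 (fun p => p \Po (w *: ('X + 1)))).
rewrite linear_sum /= => h.
transitivity (\sum_j ((b j *: 'X^(k j)) \Po (w *: ('X + 1)))).
  apply: eq_bigr => j _.
  by rewrite comp_polyZ comp_Xn_poly exprZn scalerA.
rewrite h comp_polyZ rmorph_prod /= big_map -scalerA; congr (_ *: _).
elim: rs {h} => [|z rs IH]; first by rewrite !big_nil expr0 scale1r.
have hz : ('X - z%:P) \Po (w *: ('X + 1)) = w *: ('X - (z / w - 1)%:P).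
  have hw : w *: (z / w - 1)%:P = (z - w)%:P.
    by rewrite -mul_polyC -polyCM mulrBr mulr1 mulrC divfK.
  rewrite comp_polyB comp_polyX comp_polyC scalerBr hw polyCB opprB.
  by rewrite scalerDr alg_polyC addrA.
by rewrite !big_cons IH hz /= exprS -scalerAl -scalerAr scalerA.
Qed.

Lemma few_roots_near (R : rcfType) (L D : nat) :
  exists eps eta : R, [/\ 0 < eps, 0 < eta, eta <= 1 &
    forall (k : 'I_L.+1 -> nat), injective k -> (forall j, (k j <= D)%N) ->
    forall (b : 'I_L.+1 -> R[i]) (c : R[i]) (rs : seq R[i]), (size rs <= D)%N ->
    \sum_j b j *: 'X^(k j) = c *: \prod_(z <- rs) ('X - z%:P) ->
    forall (I : {set 'I_L.+1}) (m : 'I_L.+1) (w : R[i]),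
    w != 0 -> m \in I -> b m != 0 ->
    (forall j, j \notin I ->
       normc (b j) * normc w ^+ k j <= eta * (normc (b m) * normc w ^+ k m)) ->
    (count (fun z => normc (z - w) < eps * normc w)%R rs < #|I|)%N].
Proof.
have [eps [eta [e0 eta0 eta1 H]]] := few_roots_near_1 R L D.
exists eps, eta; split=> // k kinj kD b c rs srs hb I m w w0 mI bm hout.
have nw0 : 0 < normc w by rewrite normc_gt0.
have hm := H k kinj kD I (fun j => b j * w ^+ k j) m mI.
have bm' : b m * w ^+ k m != 0 by rewrite mulf_neq0// expf_neq0.
have hout' j : j \notin I ->
    normc (b j * w ^+ k j) <= eta * normc (b m * w ^+ k m).
  by move=> jI; rewrite !Normc.normcM !normcX hout.
have := hm bm' hout' _ _ _ (recentre_sparse w0 hb).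
rewrite size_map => /(_ srs); rewrite count_map.
congr (_ < _)%N; apply: eq_count => z /=.
have -> : z / w - 1 = (z - w) / w by rewrite mulrBl divff.
by rewrite Normc.normcM Normc.normcV ltr_pdivrMr.
Qed.

Lemma root_sparse (R : rcfType) (I : finType) (k : I -> nat)
    (b : I -> R[i]) (c w : R[i]) (rs : seq R[i]) :
  \sum_j b j *: 'X^(k j) = c *: \prod_(z <- rs) ('X - z%:P) ->
  w \in rs -> \sum_j b j * w ^+ k j = 0.
Proof.
move=> h wrs; transitivity ((\sum_j b j *: 'X^(k j)).[w]).
  by rewrite horner_sum; apply: eq_bigr => j _; rewrite hornerZ hornerXn.
apply/rootP; rewrite h -mul_polyC rootM root_prod_XsubC wrs orbT //.
Qed.

Lemma coef_sparse (R : nzRingType) (I : finType) (k : I -> nat)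
    (b : I -> R) (i : nat) :
  (\sum_j b j *: 'X^(k j))`_i = \sum_(j | k j == i) b j.
Proof.
rewrite coef_sum [RHS]big_mkcond; apply: eq_bigr => j _.
by rewrite coefZ coefXn eq_sym; case: eqP => _; rewrite ?mulr1 ?mulr0.
Qed.

Lemma sparse_polyE (R : realType) (L : nat) (k : 'I_L.+1 -> nat) (x : R)
    (y : 'I_L.+1 -> R) : k ord0 = 0%N ->
  map_poly (real_complex R) (sparse_poly k x y) =
  \sum_j (if j == ord0 then x else y j)%:C *: 'X^(k j).
Proof.
move=> k0; rewrite /sparse_poly rmorphD rmorph_sum /= map_polyC /=.
rewrite [RHS](bigD1 ord0)//= k0 expr0 alg_polyC; congr (_ + _).
apply: eq_big => [j|j j0]; first by rewrite lt0n.
rewrite -[j == ord0]/(val j == 0%N) gtn_eqF//.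
by rewrite -mul_polyC rmorphM /= map_polyC /= map_polyXn mul_polyC.
Qed.

(** Since [i < j], there is a spare factor [W] to absorb the coefficient bound [B]. *)
Lemma term_le_below (R : realFieldType) (B g W a : R) (i j : nat) :
  0 <= a -> a <= B -> B <= g * W -> 1 <= W -> (i < j)%N -> 0 < g ->
  a * W ^+ i <= g * W ^+ j.
Proof.
move=> a0 aB Bg W1 ij g0.
have W0 : 0 <= W by exact: le_trans W1.
apply: (@le_trans _ _ ((g * W) * W ^+ i)).
  by rewrite ler_wpM2r ?exprn_ge0// (le_trans aB).
rewrite -mulrA -exprS; apply: ler_wpM2l; first exact: ltW.
by rewrite ler_weXn2l.
Qed.

(** The coefficient is small enough to absorb the excess power of [W], which is at most [A ^+ D]. *)
Lemma term_le_above (R : realFieldType) (A d g W a : R) (D i j : nat) :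
  0 <= a -> a <= d -> d * A ^+ D <= g -> 0 <= W -> W <= A -> 1 <= A ->
  (i <= j <= D)%N ->
  a * W ^+ j <= g * W ^+ i.
Proof.
move=> a0 ad dg W0 WA A1 /andP[ij jD].
rewrite -(subnK ij) exprD mulrA; apply: ler_wpM2r; first exact: exprn_ge0.
apply: le_trans dg; apply: ler_pM => //; first exact: exprn_ge0.
apply: (@le_trans _ _ (A ^+ (j - i))).
  by rewrite lerXn2r// nnegrE ?(le_trans _ A1).
by rewrite ler_weXn2l//; lia.
Qed.

Lemma powR_root_le (R : realType) (a d : R) (n : nat) :
  (0 < n)%N -> 0 <= a -> 0 <= d -> a `^ (n%:R^-1) <= d -> a <= d ^+ n.
Proof.
move=> n0 a0 d0 h.
have -> : a = (a `^ (n%:R^-1)) ^+ n.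
  by rewrite -powR_mulrn ?powR_ge0// -powRrM mulVf ?powRr1// pnatr_eq0 -lt0n.
by rewrite lerXn2r// nnegrE powR_ge0.
Qed.

Lemma powR_root_ge (R : realType) (a d : R) (n : nat) :
  (0 < n)%N -> 0 <= a -> 0 <= d -> d <= a `^ (n%:R^-1) -> d ^+ n <= a.
Proof.
move=> n0 a0 d0 h.
have -> : a = (a `^ (n%:R^-1)) ^+ n.
  by rewrite -powR_mulrn ?powR_ge0// -powRrM mulVf ?powRr1// pnatr_eq0 -lt0n.
by rewrite lerXn2r// nnegrE powR_ge0.
Qed.

Lemma card_ord_le (L : nat) (m : 'I_L.+1) :
  #|[set j : 'I_L.+1 | (j <= m)%N]| = m.+1.
Proof.
rewrite -sum1_card (eq_bigl (fun j : 'I_L.+1 => (j < m.+1)%N)); last first.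
  by move=> j; rewrite inE ltnS.
rewrite -(big_ord_widen_cond L.+1 xpredT (fun=> 1%N))//.
by rewrite sum1_card card_ord.
Qed.

Lemma card_ord_ge (L : nat) (m : 'I_L.+1) :
  #|[set j : 'I_L.+1 | (m <= j)%N]| = (L - m).+1.
Proof.
have := cardsC [set j : 'I_L.+1 | (m <= j)%N].
rewrite card_ord.
case: m => [[|m] hm] /=.
  by move=> _; rewrite subn0 -[RHS]card_ord; apply: eq_card => j; rewrite !inE.
have -> : ~: [set j : 'I_L.+1 | (m < j)%N] =
          [set j : 'I_L.+1 | (j <= Ordinal (ltnW hm))%N].
  by apply/setP => j; rewrite !inE leqNgt negbK.
rewrite card_ord_le /=; lia.
Qed.

(** * The choice of constants and the two regimes of [|x|] *)

Theorem theorem1p4 (R : realType) (L : nat) (hL : (1 <= L)%N)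
    (k : 'I_L.+1 -> nat) (hk0 : k ord0 = 0%N)
    (hk : forall i j : 'I_L.+1, (i < j)%N -> (k i < k j)%N)
    (gamma K : R) (hgamma : 0 < gamma <= 1) (hK : 1 < K) :
  exists delta epsilon C : R,
    [/\ 0 < delta, 0 < epsilon & 1 <= C] /\
    forall (x : R) (y : 'I_L.+1 -> R) (m : 'I_L.+1),
      x != 0 -> y ord_max != 0 ->
      \big[Num.max/0]_(j < L.+1 | (0 < j)%N) `|y j| = 1 ->
      (0 < m)%N ->
      gamma <= `|y m| `^ ((k m)%:R^-1) ->
      (forall n : 'I_L.+1, (m < n)%N -> `|y n| `^ ((k n)%:R^-1) <= delta) ->
      let Psi := sparse_poly k x y in
      exists (s1 s2 : nat) (T : nat -> seq R[i]),
        let s := (s1 + s2)%N in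
        (1 <= s <= L)%N /\
        tier_partition s T (complex_roots Psi) /\
        (* (i) *)
        (forall (i : nat) (w w' : R[i]), (1 <= i < s)%N ->
           w \in T i -> w' \in T i.+1 -> K * Normc.normc w' <= Normc.normc w) /\
        (* (ii) *)
        (forall (r : nat) (w : R[i]), (1 <= r <= s1)%N -> w \in T r ->
           C^-1 <= Normc.normc w) /\
        (forall (r : nat) (w : R[i]), (s1 < r <= s1 + s2)%N -> w \in T r ->
           Normc.normc w <= C) /\
        (* (iii) *)
        (forall (r : nat) (w : R[i]), (1 <= r <= s1)%N -> w \in T r ->
           (num_roots_in Psi (cball w (epsilon * Normc.normc w)) <= L - m + 1)%N) /\
        (* (iv) *)
        ((1 <= s2)%N ->
           (forall (r : nat) (w : R[i]), (s1 < r <= s1 + s2)%N -> w \in T r ->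
              (num_roots_in Psi (cball w (epsilon * Normc.normc w)) <= m)%N) /\
           (forall (r : nat) (w : R[i]), (1 <= r <= s1)%N -> w \in T r ->
              (num_roots_in Psi (cball w (epsilon * Normc.normc w)) <= L - m)%N)).
Proof.
have g0 : 0 < gamma by case/andP: hgamma.
have g1 : gamma <= 1 by case/andP: hgamma.
pose D := k ord_max.
have kle (i j : 'I_L.+1) : (i <= j)%N -> (k i <= k j)%N.
  rewrite leq_eqVlt => /orP[/eqP/val_inj->//|/hk/ltnW//].
have kD j : (k j <= D)%N by apply: kle; rewrite -ltnS.
have kinj : injective k.
  move=> i j kij; apply: val_inj => /=.
  by case: (ltngtP i j) => // /hk; rewrite kij ltnn.
have [eps [eta [e0 eta0 eta1 near]]] := few_roots_near R L D.
(* [gamma ^+ D] bounds [|y m|] from below, so a term of modulus at most [g * normc w ^+ k m] is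
   negligible against term [m]. *)
pose g := eta * gamma ^+ D.
have gD1 : gamma ^+ D <= 1 by rewrite exprn_ile1// ltW.
have gg0 : 0 < g by rewrite mulr_gt0 ?exprn_gt0.
have gg1 : g <= 1 by rewrite mulr_ile1 ?(ltW eta0)// exprn_ge0 ?(ltW g0).
(* For [normc w >= W0], a coefficient of modulus at most 1 and index below [m] gives a negligible
   term. From modulus [A1] on, the same holds for coefficients up to [X0], the threshold for
   [|x|]. *)
pose W0 := g^-1.
have W01 : 1 <= W0 by rewrite invf_ge1.
pose X0 := L.+1%:R * W0 ^+ D.
have X01 : 1 <= X0.
  by apply: mulr_ege1; rewrite ?exprn_ege1// ler1n.
pose A1 := X0 / g.
have A11 : 1 <= A1 by exact: mulr_ege1.
(* The gap factor is enlarged so that a gap forces a nonzero coefficient. *)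
pose K' := Num.max K (D%:R * 2 ^+ D + 1).
have KK' : K <= K' by rewrite le_max lexx.
have DK' : D%:R * 2 ^+ D < K'.
  by rewrite lt_max; apply/orP; right; rewrite ltrDl ltr01.
have K'1 : 1 <= K' by apply: le_trans KK'; exact: ltW.
pose A2 := K' * A1.
have A12 : A1 <= A2 by rewrite ler_peMl// (le_trans _ A11).
have A21 : 1 <= A2 by exact: le_trans A12.
(* This makes the terms above [m] negligible for all moduli up to [A2]. *)
pose delta := g / A2 ^+ D.
have A2D1 : 1 <= A2 ^+ D by rewrite exprn_ege1.
have A2D0 : 0 < A2 ^+ D by exact: lt_le_trans A2D1.
have delta0 : 0 < delta by rewrite divr_gt0.
have delta1 : delta <= 1.
  by rewrite ler_pdivrMr// mul1r (le_trans gg1).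
exists delta, eps, A2; split=> // x y m x0 yL ymax m0 hym hyn Psi.
pose b (j : 'I_L.+1) : R[i] := (if j == ord0 then x else y j)%:C.
pose c : R[i] := (lead_coef Psi)%:C.
pose rts := complex_roots Psi.
have PE : \sum_j b j *: 'X^(k j) = c *: \prod_(z <- rts) ('X - z%:P).
  by rewrite -complex_rootsE sparse_polyE.
have bpos (j : 'I_L.+1) : (0 < j)%N -> normc (b j) = `|y j|.
  by move=> j0; rewrite /b -[j == ord0]/(val j == 0%N) gtn_eqF// normc_real.
have b0E : normc (b ord0) = `|x| by rewrite /b eqxx normc_real.
have coefE j : (\sum_j b j *: 'X^(k j))`_(k j) = b j.
  by rewrite coef_sparse (eq_bigl _ _ (inj_eq kinj ^~ j)) big_pred1_eq.
have c0 : c != 0.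
  apply: contraNneq x0 => c0; have := coefE ord0.
  by rewrite PE c0 scale0r coef0 => h; have := b0E; rewrite -h Normc.normc0 => /esym/eqP; rewrite normr_eq0.
have size_rts : size rts = D.
  have sP : size (\sum_j b j *: 'X^(k j)) = (size rts).+1.
    by rewrite PE size_scale// size_prod_XsubC.
  apply/eqP; rewrite eqn_leq -ltnS -sP -[X in _ && X]ltnS -sP; apply/andP; split.
    apply/leq_sizeP => i Di; rewrite coef_sparse big1// => j /eqP kj.
    by have := kD j; rewrite kj leqNgt Di.
  rewrite ltnNge; apply/negP => /leq_sizeP/(_ _ (leqnn D)).
  rewrite coefE /b -[ord_max == ord0]/(L == 0%N) gtn_eqF// => /eqP.
  by rewrite fmorph_eq0; exact/negP.
have D0 : (0 < D)%N.
  by rewrite -hk0; apply: hk.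
have rtsn : rts != [::] by rewrite -size_eq0 size_rts -lt0n.
have rts0 : 0 \notin rts.
  apply/negP => /(root_sparse PE).
  rewrite (bigD1 ord0)//= big1 => [|j j0]; last first.
    rewrite expr0n gtn_eqF ?mulr0// (leq_trans _ (hk ord0 j _)) ?hk0//.
    by rewrite lt0n.
  rewrite hk0 expr0 mulr1 addr0 /b eqxx => /eqP.
  by rewrite fmorph_eq0; exact/negP.
have y1 (j : 'I_L.+1) : (0 < j)%N -> `|y j| <= 1.
  move=> j0; rewrite -ymax.
  exact: (le_bigmax_cond 0 (fun j => `|y j|) j0).
have kpos (j : 'I_L.+1) : (0 < j)%N -> (0 < k j)%N.
  by move=> j0; rewrite -hk0; apply: hk.
have bm : gamma ^+ D <= normc (b m).
  rewrite bpos//; apply: le_trans (_ : gamma ^+ k m <= _).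
    by rewrite ler_wiXn2l ?kD// ltW.
  by apply: powR_root_ge => //; [exact: kpos|exact: ltW].
have bm0 : b m != 0.
  by rewrite -normc_gt0 (lt_le_trans _ bm)// exprn_gt0.
have bbig (j : 'I_L.+1) : (m < j)%N -> normc (b j) <= delta.
  move=> mj; have j0 : (0 < j)%N by exact: leq_ltn_trans mj.
  rewrite bpos//; apply: le_trans (_ : delta ^+ k j <= _).
    by apply: powR_root_le (hyn j mj) => //; [exact: kpos|exact: ltW].
  by rewrite -[leRHS]expr1 ler_wiXn2l ?kpos// ltW.
have main j (w : R[i]) :
    normc (b j) * normc w ^+ k j <= g * normc w ^+ k m ->
    normc (b j) * normc w ^+ k j <= eta * (normc (b m) * normc w ^+ k m).
  move=> h; apply: le_trans h _.
  by rewrite /g -mulrA ler_pM2l// ler_wpM2r// exprn_ge0// normc_ge0.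
have below B (j : 'I_L.+1) (w : R[i]) : normc (b j) <= B -> B <= g * normc w ->
    1 <= normc w -> (j < m)%N ->
    normc (b j) * normc w ^+ k j <= eta * (normc (b m) * normc w ^+ k m).
  move=> h1 h2 h3 jm; apply: main.
  by apply: term_le_below h1 h2 h3 _ _ => //; [exact: normc_ge0|exact: hk].
have above (j : 'I_L.+1) (w : R[i]) : normc w <= A2 -> (m < j)%N ->
    normc (b j) * normc w ^+ k j <= eta * (normc (b m) * normc w ^+ k m).
  move=> h mj; apply: main.
  apply: (@term_le_above _ A2 delta _ _ _ D) => //.
  - exact: normc_ge0.
  - exact: bbig.
  - by rewrite /delta divfK// gt_eqF.
  - exact: normc_ge0.
  - by rewrite kle ?kD// ltnW.
have rw0 w : w \in rts -> w != 0 by apply: contraTneq => ->.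
have nroots (I : {set 'I_L.+1}) w : w \in rts -> m \in I ->
    (forall j, j \notin I ->
      normc (b j) * normc w ^+ k j <= eta * (normc (b m) * normc w ^+ k m)) ->
    (num_roots_in Psi (cball w (eps * normc w)) < #|I|)%N.
  move=> wr mI h.
  exact: (near k kinj kD b c rts (eq_leq size_rts) PE I m w (rw0 _ wr) mI bm0 h).
pose Ige := [set j : 'I_L.+1 | (m <= j)%N].
pose e := [seq k j | j <- enum 'I_L.+1].
have size_e : size e = L.+1 by rewrite size_map size_enum_ord.
have he i : (c *: \prod_(z <- rts) ('X - z%:P))`_i != 0 -> i \in e.
  rewrite -PE coef_sparse; apply: contraNT => ie.
  rewrite big1// => j /eqP kj; case/negP: ie.
  by rewrite -kj map_f// mem_enum.
have srD : (size rts <= D)%N by rewrite size_rts.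
(* Only a splitting of the roots into large and small remains to be found; tiers of large roots are
   numbered first. *)
suff [large [hsep hlC hsC hl3 [hs4 hl4]]] : exists large : pred R[i], [/\
    {in rts &, forall z z', large z -> ~~ large z' -> K' * normc z' <= normc z},
    {in rts, forall z, large z -> A2^-1 <= normc z},
    {in rts, forall z, ~~ large z -> normc z <= A2},
    {in rts, forall z, large z ->
       (num_roots_in Psi (cball z (eps * normc z)) <= L - m + 1)%N} &
    {in rts, forall z, ~~ large z ->
       (num_roots_in Psi (cball z (eps * normc z)) <= m)%N} /\
    {in rts &, forall z z', large z -> ~~ large z' ->
       (num_roots_in Psi (cball z (eps * normc z)) <= L - m)%N}].
  have [l [t /= [hfl hne hsz hi [hl ht]]]] :=
    tiers_exist srD DK' K'1 rts0 he c0 rtsn hsep.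
  set ts := tiers K' l ++ tiers K' t in hfl hne hsz hi.
  have inT s i (z : R[i]) : z \in nth [::] (tiers K' s) i -> z \in s.
    move=> zs; rewrite -(flatten_tiers K' s); apply/flattenP.
    exists (nth [::] (tiers K' s) i) => //; apply: mem_nth.
    by rewrite ltnNge; apply/negP => h; rewrite nth_default in zs.
  have inl i z : (i < size (tiers K' l))%N -> z \in nth [::] ts i ->
      z \in rts /\ large z.
    rewrite /ts nth_cat => -> /inT; rewrite hl mem_filter.
    by case/andP => /andP[].
  have int i z : (size (tiers K' l) <= i)%N -> z \in nth [::] ts i ->
      z \in rts /\ ~~ large z.
    rewrite /ts nth_cat ltnNge => -> /inT; rewrite ht mem_filter.
    by case/andP => /andP[].
  exists (size (tiers K' l)), (size (tiers K' t)), (fun r => nth [::] ts r.-1).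
  rewrite /= -size_cat -/ts; split; first by rewrite size_e ltnS in hsz.
  split; first exact: tier_partition_nth.
  split.
    case=> [//|i] w w' /andP[_ his] wi wi'.
    apply: le_trans (hi i his w w' wi wi').
    by rewrite ler_wpM2r// normc_ge0.
  split.
    by case=> [//|r] w /andP[_ hr] /(inl _ _ hr)[wr lw]; exact: hlC.
  split.
    by case=> [//|r] w /andP[hr _] /(int _ _ hr)[wr lw]; exact: hsC.
  split.
    by case=> [//|r] w /andP[_ hr] /(inl _ _ hr)[wr lw]; exact: hl3.
  move=> s20; split.
    by case=> [//|r] w /andP[hr _] /(int _ _ hr)[wr lw]; exact: hs4.
  (* A nonempty small tier supplies the small root on which the sharper bound [L - m] for large
     roots depends. *)
  have [z [zr zl]] : exists z, z \in rts /\ ~~ large z.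
    move: s20; rewrite lt0n size_eq0 tiers_eq_nil => tn.
    exists (head 0 t).
    have : head 0 t \in t by case: (t) tn => //= u v _; rewrite inE eqxx.
    by rewrite {2}ht mem_filter => /andP[/andP[]].
  by case=> [//|r] w /andP[_ hr] /(inl _ _ hr)[wr lw]; exact: (hl4 w z).
have [xX|xX] := lerP `|x| X0.
  have bX j : normc (b j) <= X0.
    have [->|j0] := eqVneq j ord0; first by rewrite b0E.
    by rewrite bpos ?lt0n// (le_trans (y1 _ _)) ?lt0n.
  have gA w : A1 <= normc w -> X0 <= g * normc w.
    by rewrite ler_pdivrMr// mulrC.
  have lge w : w \in rts -> A1 <= normc w ->
      (num_roots_in Psi (cball w (eps * normc w)) <= L - m)%N.
    move=> wr hw; rewrite -ltnS -card_ord_ge; apply: nroots => //.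
      by rewrite inE.
    move=> j; rewrite inE -ltnNge => jm; apply: (below X0) => //.
    - exact: gA.
    - exact: le_trans hw.
  have sle w : w \in rts -> normc w <= A2 ->
      (num_roots_in Psi (cball w (eps * normc w)) <= m)%N.
    move=> wr hw; rewrite -ltnS -card_ord_le; apply: nroots => //.
      by rewrite inE.
    by move=> j; rewrite inE -ltnNge => mj; apply: above.
  (* With [I = {m}] the ball about a root [w] in the annulus would contain no root at all, yet it
     contains [w]. *)
  have annulus w : w \in rts -> A1 <= normc w -> A2 < normc w.
    move=> wr hw; rewrite ltNge; apply/negP => hw2.
    have : (num_roots_in Psi (cball w (eps * normc w)) < #|[set m]|)%N.
      apply: nroots => //; first by rewrite inE.
      move=> j; rewrite inE neq_ltn => /orP[jm|mj]; last exact: above.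
      apply: (below X0) => //; first exact: gA.
      exact: le_trans hw.
    rewrite cards1 ltnS leqn0 => /eqP h.
    have : has (cball w (eps * normc w)) rts.
      apply/hasP; exists w => //.
      by rewrite /cball subrr Normc.normc0 mulr_gt0// normc_gt0 rw0.
    by rewrite has_count -/(num_roots_in Psi _) h.
  (* Large roots in fact exceed [A2 = K' * A1], and small ones lie below [A1], which gives the
     factor [K']. *)
  exists (fun z => A1 <= normc z); split.
  - move=> z z' zr zr' /(annulus _ zr) hz; rewrite -ltNge => hz'.
    apply: le_trans (ltW hz); rewrite /A2 ler_wpM2l// ?(le_trans _ K'1)//.
    exact: ltW.
  - move=> z zr hz; apply: le_trans hz; apply: le_trans A11.
    by rewrite invf_le1// (lt_le_trans _ A21).
  - by move=> z zr; rewrite -ltNge => hz; apply: le_trans A12; exact: ltW.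
  - by move=> z zr hz; rewrite addn1 leqW// lge.
  - split=> [z zr|z z' zr _ hz _]; last exact: lge.
    by rewrite -ltNge => hz; apply: sle => //; apply: le_trans A12; exact: ltW.
(* Now [|x| > X0]. At a root of modulus below [W0] the other terms would add up to at most
   [L.+1 * W0 ^+ D = X0], too little to cancel [x]. *)
have wW w : w \in rts -> W0 <= normc w.
  move=> wr; rewrite leNgt; apply/negP => hw.
  have := root_sparse PE wr; rewrite (bigD1 ord0)//= hk0 expr0 mulr1.
  move=> /eqP; rewrite addr_eq0 => /eqP /(congr1 (fun z : R[i] => normc z)).
  rewrite normc_opp b0E => hx.
  have : `|x| <= #|'I_L.+1|%:R * W0 ^+ D.
    rewrite hx; apply: normc_sum_le => [|j j0].
      by rewrite exprn_ge0// (le_trans _ W01).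
    rewrite Normc.normcM normcX -[leRHS]mul1r.
    apply: ler_pM; rewrite ?exprn_ge0 ?normc_ge0//.
      by rewrite bpos ?y1// lt0n.
    apply: (@le_trans _ _ (W0 ^+ k j)); last by rewrite ler_weXn2l ?kD.
    have W0p : 0 <= W0 by exact: le_trans W01.
    by rewrite lerXn2r ?nnegrE ?normc_ge0// ltW.
  by rewrite card_ord leNgt xX.
(* All roots are large, so the claims about small roots are vacuous. *)
exists predT; split=> //.
- move=> z zr _; apply: le_trans (wW z zr); apply: le_trans W01.
  by rewrite invf_le1// (lt_le_trans _ A21).
- move=> z zr _.
  (* Since [x] may be huge, the index 0 joins the main terms; the set has [L - m + 2] elements. *)
  have : (num_roots_in Psi (cball z (eps * normc z)) < #|ord0 |: Ige|)%N.
    apply: nroots => //; first by rewrite !inE leqnn orbT.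
    move=> j; rewrite !inE negb_or -ltnNge => /andP[j0 jm].
    apply: (below 1) => //.
    - by rewrite bpos ?y1// lt0n.
    - by rewrite mulrC -ler_pdivrMr// mul1r wW.
    - exact: le_trans (wW z zr).
  by rewrite cardsU1 card_ord_ge inE -ltnNge m0 /= add1n addn1 ltnS.
Qed.
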